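(* Let $M$ be a reversible $d\times d$ Markov matrix whose minimal polynomial has degree $m\leqslant d$, and put $A=M-\mathbf{1}$. Then $M$ is reversibly embeddable if and only if the following two conditions are satisfied. (1) The spectrum of $M$ is positive, i.e. all eigenvalues of $M$ are strictly positive real numbers. (2) Writing the distinct eigenvalues of $M$ as $\lambda_0=1>\lambda_1>\cdots>\lambda_{m-1}>0$ and setting $\mu_i=\lambda_i-1$, the real coefficients $\alpha_1,\dots,\alpha_{m-1}$ that solve the (uniquely solvable) linear system $$\sum_{k=1}^{m-1}\mu_i^{k}\,\alpha_k=\log(\lambda_i),\qquad 1\leqslant i\leqslant m-1,$$ are such that $L=\log(\mathbf{1}+A)=\sum_{k=1}^{m-1}\alpha_k A^{k}$ is a Markov generator. In this case, $L$ is unique in the sense that no other reversible real logarithm of $M$ exists: if $R$ is a reversible real $d\times d$ matrix with $\mathrm{e}^{R}=M$, then $R=L$.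
   Context: $\mathbf{1}$ denotes the identity matrix. A Markov matrix is a real square matrix with non-negative entries and all row sums equal to $1$. A Markov generator is a real square matrix with non-negative off-diagonal entries and all row sums equal to $0$. A real $d\times d$ matrix $B$ is reversible if there is a strictly positive probability vector $\boldsymbol{p}=(p_1,\dots,p_d)$ (all $p_i>0$, $\sum_i p_i=1$) such that $p_iB_{ij}=p_jB_{ji}$ for all $1\leqslant i,j\leqslant d$. A reversible Markov matrix $M$ is reversibly embeddable if $M=\mathrm{e}^{Q}$ for some reversible Markov generator $Q$. A reversible matrix is diagonalisable with real spectrum, so a reversible Markov matrix with minimal polynomial of degree $m$ has exactly $m$ distinct eigenvalues. When its spectrum is positive, $A=M-\mathbf{1}$ has spectral radius less than $1$, and $\log(\mathbf{1}+A)=\sum_{n=1}^{\infty}\frac{(-1)^{n-1}}{n}A^{n}$ is the principal logarithm of $M$. *)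

(* Defs.v *)
From HB Require Import structures.
From mathcomp Require Export all_boot all_order all_algebra.
From mathcomp Require Export all_classical all_reals all_analysis.
From mathcomp Require Export complex.

Set Implicit Arguments.
Unset Strict Implicit.
Unset Printing Implicit Defensive.

Export Order.TTheory GRing.Theory Num.Theory.
Export numFieldNormedType.Exports.

Local Open Scope classical_set_scope.
Local Open Scope ring_scope.

Definition markov_matrix (R : realType) (d : nat) (M : 'M[R]_d) : Prop :=
  (forall i j, 0 <= M i j) /\ (forall i, \sum_j M i j = 1).

Definition markov_generator (R : realType) (d : nat) (Q : 'M[R]_d) : Prop :=
  (forall i j, i != j -> 0 <= Q i j) /\ (forall i, \sum_j Q i j = 0).

Definition reversible_mx (R : realType) (d : nat) (B : 'M[R]_d) : Prop :=
  exists p : 'rV[R]_d,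
    [/\ forall i, 0 < p 0 i,
        \sum_i p 0 i = 1
      & forall i j, p 0 i * B i j = p 0 j * B j i].

(* Limits of matrices are taken for the (max) norm, i.e., entrywise.
   Positive sizes [d.+1] provide the ring powers [A ^+ n]. *)
Definition mxexp (R : realType) (d : nat) (A : 'M[R]_d.+1) : 'M[R]_d.+1 :=
  limn (series (fun n : nat => n`!%:R^-1 *: A ^+ n)).

(* The summand of index [n] is the term [(-1)^n / (n + 1) A^(n + 1)], so that
   the series is [\sum_(n >= 1) (-1)^(n - 1) / n A^n]. *)
Definition mxlog1p_series (R : realType) (d : nat) (A : 'M[R]_d.+1) :
    nat -> 'M[R]_d.+1 :=
  series (fun n : nat => ((-1) ^+ n / n.+1%:R) *: A ^+ n.+1).

Definition reversibly_embeddable (R : realType) (d : nat) (M : 'M[R]_d.+1) :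
    Prop :=
  exists Q : 'M[R]_d.+1,
    [/\ markov_generator Q, reversible_mx Q & M = mxexp Q].

(* Complex eigenvalues are considered: in the order of [R[i]], [0 < z] means
   that [z] is real and positive. *)
Definition positive_spectrum (R : realType) (d : nat) (M : 'M[R]_d) : Prop :=
  forall z : R[i], eigenvalue (map_mx (real_complex R) M) z -> 0 < z.

Definition decreasing_eigenvalues (R : realType) (d : nat) (M : 'M[R]_d)
    (lam : seq R) : Prop :=
  sorted >%R lam /\ (forall x : R, (x \in lam) = eigenvalue M x).

(* The 0-based [i] and [k] stand for the indices [i.+1] and [k.+1] of the
   system; in particular [alpha 0 k] is the coefficient [alpha_(k + 1)] of the
   power [k + 1], and [lam`_0] is not used. *)
Definition log_system (R : realType) (n : nat) (lam : seq R)
    (alpha : 'rV[R]_n) : Prop :=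
  forall i : 'I_n,
    \sum_(k < n) (lam`_i.+1 - 1) ^+ k.+1 * alpha 0 k = ln lam`_i.+1.

Definition log_poly (R : realType) (d n : nat) (alpha : 'rV[R]_n)
    (A : 'M[R]_d.+1) : 'M[R]_d.+1 :=
  \sum_(k < n) alpha 0 k *: A ^+ k.+1.

(* Main.v *)
Require Import Defs.
From mathcomp Require Import ring lra.

(* A reversible matrix is similar to a symmetric one, hence is a combination
   [\sum_i a i *: E i] of complementary orthogonal idempotents, and polynomials
   and power series act on the coefficients [a i].  If [R'] is reversible and
   [exp R' = M], its resolution [\sum_i w i *: E i] is also one of [M], with
   coefficients [expR (w i)]: the spectrum of [M] is positive, and since the
   polynomial [\sum_k alpha_k (x - 1)^k] takes the value [ln x] at every
   eigenvalue [x], its value at [M] is [\sum_i ln (expR (w i)) *: E i = R'].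
   This gives uniqueness and, applied to a generator, necessity; sufficiency
   holds because polynomials in [M] inherit detailed balance from [M]. *)

Set Implicit Arguments.
Unset Strict Implicit.
Unset Printing Implicit Defensive.

Local Open Scope classical_set_scope.
Local Open Scope ring_scope.

(** * Functional calculus on complementary orthogonal idempotents *)

(** Nonzero [E i] ensure that every coefficient of a combination is an eigenvalue. Coefficients may
    repeat, so the [E i] need not be full eigenprojections. *)
Definition spectral_resolution (F : fieldType) (n : nat) (I : finType)
    (E : I -> 'M[F]_n.+1) : Prop :=
  [/\ forall i, E i != 0,
      forall i j, E i * E j = (i == j)%:R *: E i
    & \sum_i E i = 1].

Lemma resolution_mul (F : fieldType) (n : nat) (I : finType)
    (E : I -> 'M[F]_n.+1) (a b : I -> F) :
  spectral_resolution E ->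
  (\sum_i a i *: E i) * (\sum_i b i *: E i) = \sum_i (a i * b i) *: E i.
Proof.
move=> [_ EE _]; rewrite mulr_suml; apply: eq_bigr => i _.
rewrite mulr_sumr (bigD1 i)//= big1 ?addr0 => [|j ji].
  by rewrite -scalerAl -scalerAr EE eqxx scale1r scalerA.
by rewrite -scalerAl -scalerAr EE eq_sym (negPf ji) scale0r !scaler0.
Qed.

Lemma resolution_exp (F : fieldType) (n : nat) (I : finType)
    (E : I -> 'M[F]_n.+1) (a : I -> F) (k : nat) :
  spectral_resolution E -> (\sum_i a i *: E i) ^+ k = \sum_i a i ^+ k *: E i.
Proof.
move=> resE; elim: k => [|k IHk].
  case: resE => _ _ E1; rewrite expr0 -E1.
  by apply: eq_bigr => i _; rewrite expr0 scale1r.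
by rewrite exprS IHk resolution_mul//; apply: eq_bigr => i _; rewrite exprS.
Qed.

Lemma resolution_horner (F : fieldType) (n : nat) (I : finType)
    (E : I -> 'M[F]_n.+1) (a : I -> F) (p : {poly F}) :
  spectral_resolution E ->
  horner_mx (\sum_i a i *: E i) p = \sum_i p.[a i] *: E i.
Proof.
move=> resE; rewrite -{1}(coefK p) poly_def.
rewrite raddf_sum /=; under eq_bigr => k _.
  rewrite linearZ/= rmorphXn/= horner_mx_X (resolution_exp _ _ resE).
  rewrite scaler_sumr.
  over.
rewrite exchange_big/=; apply: eq_bigr => i _.
by rewrite horner_coef scaler_suml; apply: eq_bigr => k _; rewrite scalerA.
Qed.

Lemma resolution_map (F K : fieldType) (f : {rmorphism F -> K}) (n : nat)
    (I : finType) (E : I -> 'M[F]_n.+1) :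
  spectral_resolution E -> spectral_resolution (fun i => map_mx f (E i)).
Proof.
move=> [E0 EE E1]; split => [i|i j|].
- by rewrite map_mx_eq0.
- by rewrite -[_ * _]/(_ *m _) -map_mxM [_ *m _]EE map_mxZ rmorph_nat.
- by rewrite -map_mx_sum E1 map_mx1.
Qed.

(** An eigenvector [u] is the sum of its components [u *m E j], and a nonzero one forces [x = a j].
    Conversely, any nonzero row of [E i] is a left eigenvector for [a i]. *)
Lemma resolution_eigenvalue (F : fieldType) (n : nat) (I : finType)
    (E : I -> 'M[F]_n.+1) (a : I -> F) (x : F) :
  spectral_resolution E ->
  eigenvalue (\sum_i a i *: E i) x <-> exists i, x = a i.
Proof.
move=> [E0 EE E1]; set M := \sum_i _.
have EEm i j : E i *m E j = (i == j)%:R *: E i := EE i j.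
have ME i : E i *m M = a i *: E i /\ M *m E i = a i *: E i.
  split.
    rewrite mulmx_sumr (bigD1 i)//= big1 ?addr0 => [|j ji].
      by rewrite -scalemxAr (EEm i i) eqxx scale1r.
    by rewrite -scalemxAr (EEm i j) eq_sym (negPf ji) scale0r scaler0.
  rewrite mulmx_suml (bigD1 i)//= big1 ?addr0 => [|j ji].
    by rewrite -scalemxAl (EEm i i) eqxx scale1r.
  by rewrite -scalemxAl (EEm j i) (negPf ji) scale0r scaler0.
split=> [/eigenvalueP[u uM u0]|[i ->]].
  have [j uj0] : exists j, u *m E j != 0.
    apply/existsP; apply: contraNT u0 => /existsPn u0.
    rewrite -(mulmx1 u) -[1%:M]/1 -E1 mulmx_sumr big1// => j _.
    by apply/eqP; rewrite -[_ == _]negbK u0.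
  exists j; apply/eqP; rewrite -subr_eq0.
  have : (x - a j) *: (u *m E j) == 0.
    by rewrite scalerBl scalemxAl -uM -mulmxA (ME j).2 -scalemxAr subrr.
  by rewrite scaler_eq0 (negPf uj0) orbF.
have [r /eqP Er0|Er0] := pickP (fun r => row r (E i) != 0).
  apply/eigenvalueP; exists (row r (E i)); last exact/eqP.
  by rewrite -row_mul (ME i).1 linearZ.
case/eqP: (E0 i); apply/row_matrixP => r; rewrite row0.
by apply/eqP; have := Er0 r => /negbFE.
Qed.

(** * Diagonalisability of reversible matrices *)

Lemma diagonalizable_resolution (F : fieldType) (n : nat) (B : 'M[F]_n.+1) :
  diagonalizable B ->
  exists (E : 'I_n.+1 -> 'M[F]_n.+1) (a : 'I_n.+1 -> F),
    spectral_resolution E /\ B = \sum_i a i *: E i.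
Proof.
move=> [P uP /(similar_diagLR uP)[v ->]].
(* The idempotents are the diagonal matrix units, conjugated back from the eigenbasis [P]. *)
exists (fun i => conjmx (invmx P) (delta_mx i i)), (v 0).
have uP' : invmx P \in unitmx by rewrite unitmx_inv.
have Edef i : conjmx (invmx P) (delta_mx i i) = invmx P *m delta_mx i i *m P.
  by rewrite conjumx// invmxK.
split; [split=> [i|i j|]|].
- apply/eqP => /(congr1 (conjmx P)); rewrite conjmxVK// conjmx0.
  by move/matrixP/(_ i i); rewrite !mxE !eqxx => /eqP; rewrite oner_eq0.
- rewrite !Edef -[_ * _]/(_ *m _) !mulmxA mulmxK// -(mulmxA _ _ (delta_mx j j)).
  rewrite mul_delta_mx_cond; case: eqVneq => [->|_]; rewrite ?scale1r//.
  by rewrite scale0r mulr0n mulmx0 mul0mx.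
- under eq_bigr do rewrite Edef.
  rewrite -mulmx_suml -mulmx_sumr -[X in _ *m X *m _]mx1_sum_delta mulmx1.
  exact: mulVmx.
- under eq_bigr do rewrite Edef scalemxAl scalemxAr.
  by rewrite -mulmx_suml -mulmx_sumr -diag_mx_sum_delta conjumx ?invmxK.
Qed.

(* The spectral theorem is only available over [R[i]]; it descends to [R] since
   the minimal polynomial is the same and its complex roots are real. *)
Lemma realsym_diagonalizable (R : realType) (n : nat) (S : 'M[R]_n.+1) :
  S^T = S -> diagonalizable S.
Proof.
move=> ST; apply/diagonalizableP.
set C := map_mx (real_complex R) S.
have Cherm : C \is hermsymmx.
  apply: realsym_hermsym.
    by apply/is_hermitianmxP; rewrite scale1r map_mx_id// /C map_trmx ST.
  by apply/mxOverP => i j; rewrite mxE; apply/complex_realP; exists (S i j).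
have /hermitian_normalmx/orthomx_spectralP Cdiag := Cherm.
have /mxOverP vreal := hermitian_spectral_diag_real Cherm.
set P := spectralmx C in Cdiag; set v := spectral_diag C in Cdiag vreal.
have uP : P \in unitmx by apply: unitarymx_unit; exact: spectral_unitarymx.
(* The criterion asks for pairwise distinct real roots, whence [undup]; taking real parts loses
   nothing, as the entries of [v] are real. *)
exists (undup [seq complex.Re (v 0 i) | i <- enum 'I_n.+1]).
  exact: undup_uniq.
rewrite -(dvdp_map (real_complex R)) map_prod_XsubC -mxminpoly_map -/C.
have CE : C = conjmx (invmx P) (diag_mx v) by rewrite conjVmx.
rewrite CE mxminpoly_uconj ?unitmx_inv// mxminpoly_diag.
apply: uniq_roots_dvdp; last by rewrite uniq_rootsE undup_uniq.
apply/allP => z; rewrite mem_undup => /mapP[i _ ->].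
rewrite /root horner_prod prodf_seq_eq0; apply/hasP.
exists (complex.Re (v 0 i)); last by rewrite /= hornerXsubC RRe_real ?subrr.
by rewrite mem_undup; apply/map_f; rewrite mem_enum.
Qed.

(* Conjugation by the square root of the diagonal matrix of [p] turns detailed
   balance into symmetry. *)
Lemma reversible_diagonalizable (R : realType) (n : nat) (B : 'M[R]_n.+1) :
  reversible_mx B -> diagonalizable B.
Proof.
move=> [p [p0 _ pB]].
pose s : 'rV[R]_n.+1 := \row_i Num.sqrt (p 0 i).
pose t : 'rV[R]_n.+1 := \row_i (Num.sqrt (p 0 i))^-1.
have s0 i : Num.sqrt (p 0 i) != 0 by rewrite gt_eqF// sqrtr_gt0.
have st : diag_mx s *m diag_mx t = 1%:M.
  rewrite mulmx_diag -diag_const_mx; congr diag_mx.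
  by apply/rowP => i; rewrite !mxE divff.
have [us _] := mulmx1_unit st.
have ts : invmx (diag_mx s) = diag_mx t.
  by rewrite -[RHS](mulKmx us) st mulmx1.
(* Diagonalisability depends only on the minimal polynomial, which conjugation preserves. *)
apply/diagonalizableP; rewrite -(mxminpoly_uconj B us).
apply/diagonalizableP; apply: realsym_diagonalizable.
rewrite conjumx// ts; apply/matrixP => i j.
rewrite mxE !mul_mx_diag !mul_diag_mx !mxE.
have pE k : p 0 k = Num.sqrt (p 0 k) ^+ 2 by rewrite sqr_sqrtr ?ltW.
move: (pB i j) (s0 i) (s0 j); rewrite {1}(pE i) {1}(pE j).
move: (Num.sqrt _) (Num.sqrt _) => x y xy x0 y0.
(* Multiplying by both square roots clears the denominators and leaves detailed balance. *)
apply: (mulIf x0); apply: (mulIf y0); rewrite mulfVK// [RHS]mulrAC mulfVK//.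
by rewrite [LHS]mulrAC [RHS]mulrAC -!expr2 xy.
Qed.

(** * Exponential and logarithm series *)

Lemma cvg_sumZ (K : numFieldType) (V : normedModType K) (I : finType)
    (E : I -> V) (u : I -> K^nat) (l : I -> K) :
  (forall i, u i @ \oo --> l i) ->
  (fun n => \sum_i u i n *: E i) @ \oo --> \sum_i l i *: E i.
Proof.
move=> ul; apply: cvg_big => [|i _]; first exact: add_continuous.
exact: cvgZr_tmp.
Qed.

(** Differentiating the Taylor remainder leaves [1 / (1 - y)] minus a finite geometric sum. *)
Lemma ln1B_remainder (R : realType) (N : nat) (y : R) : y < 1 ->
  is_derive y 1 (fun z => - ln (1 - z) - \sum_(k < N) z ^+ k.+1 / k.+1%:R)
    (y ^+ N / (1 - y)).
Proof.
move=> y1; have y1' : 1 - y != 0 by lra.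
elim: N => [|N IHN].
  rewrite (_ : (fun _ => _) = fun z => - ln (1 - z)); last first.
    by apply/funext => z; rewrite big_ord0 subr0.
  have dln : is_derive (1 - y) 1 (@ln R) (1 - y)^-1.
    by apply: is_derive1_ln; lra.
  have d1 : is_derive y 1 (fun z : R => 1 - z) (0 - 1) by exact: is_deriveB.
  have -> : y ^+ 0 / (1 - y) = - ((1 - y)^-1 * (0 - 1)) by rewrite expr0; field.
  by apply: is_deriveN; apply: is_derive1_comp.
have -> : y ^+ N.+1 / (1 - y) = y ^+ N / (1 - y) - y ^+ N.
  by rewrite exprS; field.
rewrite (_ : (fun _ => _) = 
  (fun z => - ln (1 - z) - \sum_(k < N) z ^+ k.+1 / k.+1%:R) -
  (N.+1%:R^-1 \*: (@id R ^+ N.+1))); last first.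
  apply/funext => z; rewrite big_ord_recr/= opprD addrA; congr (_ - _).
  by rewrite /= mulrC; congr (_ * _); rewrite fctE.
apply: is_deriveB.
have -> : y ^+ N = N.+1%:R^-1 *: ((N.+1%:R * y ^+ N) *: 1) :> R.
  by rewrite /GRing.scale/= mulr1 mulKf// pnatr_eq0.
by apply: is_deriveZ; apply: is_deriveX.
Qed.

(** By the mean value theorem the remainder is [c ^+ N / (1 - c) * y] for some [c] in []0, y[],
    which is squeezed between 0 and a multiple of [y ^+ N]. *)
Lemma ln1B_series (R : realType) (y : R) : 0 <= y < 1 ->
  series (fun n => y ^+ n.+1 / n.+1%:R) @ \oo --> - ln (1 - y).
Proof.
move=> /andP[y0 y1].
have bound N : 0 <= - ln (1 - y) - series (fun n => y ^+ n.+1 / n.+1%:R) N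
                 <= y ^+ N * (y / (1 - y)).
  pose f z := - ln (1 - z) - \sum_(k < N) z ^+ k.+1 / k.+1%:R : R.
  have fd (z : R) : z < 1 -> is_derive z 1 f (z ^+ N / (1 - z)).
    exact: ln1B_remainder.
  have := @MVT_segment R f (fun z : R => z ^+ N / (1 - z)) 0 y y0.
  case=> [z /[!in_itv]/= /andP[_ zy]||c].
  - by apply: fd; exact: lt_trans y1.
  - apply: derivable_within_continuous => z; rewrite in_itv/= => /andP[_ zy].
    by have [] := fd z (le_lt_trans zy y1).
  rewrite in_itv/= => /andP[c0 cy].
  have -> : f 0 = 0.
    rewrite /f subr0 ln1 oppr0 sub0r big1 ?oppr0// => k _.
    by rewrite expr0n mul0r.
  rewrite !subr0 {1}/f /series/= big_mkord => ->.
  apply/andP; split.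
    by rewrite !mulr_ge0 ?exprn_ge0 ?invr_ge0//; lra.
  rewrite [leRHS]mulrCA mulrC; apply: ler_wpM2l => //.
  apply: ler_pM; rewrite ?exprn_ge0 ?invr_ge0 ?lerXn2r ?nnegrE//; first by lra.
  by rewrite lef_pV2 ?posrE; lra.
have : - ln (1 - y) - series (fun n => y ^+ n.+1 / n.+1%:R) N
    @[N --> \oo] --> 0.
  apply: (@squeeze_cvgr _ _ _ _ (cst 0) (fun n => y ^+ n * (y / (1 - y)))).
  - by near=> N; exact: bound.
  - exact: cvg_cst.
  - rewrite -(mul0r (y / (1 - y))); apply: cvgMr_tmp.
    by apply: cvg_expr; rewrite ger0_norm.
move=> /cvgN; rewrite oppr0 => h.
apply: (cvg_sub0 (g := cst (- ln (1 - y)))); last exact: cvg_cst.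
move: h; rewrite (_ : - _ =
  series (fun n => y ^+ n.+1 / n.+1%:R) - cst (- ln (1 - y)))//.
by apply/funext => n; rewrite !fctE opprB.
Unshelve. all: by end_near. Qed.

Lemma expR_series (R : realType) (x : R) :
  series (fun n => n`!%:R^-1 * x ^+ n) @ \oo --> expR x.
Proof. by rewrite -exp_coeffE; exact: is_cvg_series_exp_coeff. Qed.

Lemma resolution_mxexp (R : realType) (n : nat) (I : finType)
    (E : I -> 'M[R]_n.+1) (a : I -> R) :
  spectral_resolution E ->
  mxexp (\sum_i a i *: E i) = \sum_i expR (a i) *: E i.
Proof.
move=> resE; apply: cvg_lim => //.
rewrite (_ : series _ = fun N =>
  \sum_i series (fun k => k`!%:R^-1 * a i ^+ k) N *: E i).
  by apply: cvg_sumZ => i; exact: expR_series.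
apply/funext => N; rewrite /series/=.
under eq_bigr do rewrite (resolution_exp _ _ resE) scaler_sumr.
rewrite exchange_big; apply: eq_bigr => i _.
by rewrite scaler_suml; apply: eq_bigr => k _; rewrite scalerA.
Qed.

Lemma resolution_mxlog1p (R : realType) (n : nat) (I : finType)
    (E : I -> 'M[R]_n.+1) (a : I -> R) :
  spectral_resolution E -> (forall i, -1 < a i <= 0) ->
  mxlog1p_series (\sum_i a i *: E i) @ \oo --> \sum_i ln (1 + a i) *: E i.
Proof.
move=> resE a1; rewrite /mxlog1p_series.
(* Substituting [y = - a i], which lies in [[0, 1[], turns the alternating series into minus that of
   [- ln (1 - y)]. *)
rewrite (_ : series _ = fun N =>
  \sum_i (- series (fun k => (- a i) ^+ k.+1 / k.+1%:R) N) *: E i).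
  apply: cvg_sumZ => i; rewrite -[ln _]opprK -{2}[a i]opprK.
  by apply: cvgN; apply: ln1B_series; have := a1 i; lra.
apply/funext => N; rewrite /series/=.
under eq_bigr do rewrite (resolution_exp _ _ resE) scaler_sumr.
rewrite exchange_big; apply: eq_bigr => i _.
rewrite -sumrN scaler_suml; apply: eq_bigr => k _.
rewrite scalerA [(- a i) ^+ _]exprNn [(-1) ^+ k.+1]exprS.
by congr (_ *: _); ring.
Qed.

(** * Eigenvalues and the minimal polynomial *)

(** Right multiplication by [M] does not increase the l1 norm of a row vector; this is applied to a
    left eigenvector. *)
Lemma markov_eigenvalue_le1 (R : realType) (d : nat) (M : 'M[R]_d.+1) (x : R) :
  markov_matrix M -> eigenvalue M x -> x <= 1.
Proof.
move=> [M0 M1] /eigenvalueP[u uM u0].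
have s0 : 0 < \sum_i `|u 0 i|.
  rewrite lt_neqAle sumr_ge0// andbT eq_sym; apply: contraNneq u0 => su.
  apply/eqP/rowP => i; rewrite mxE; apply/eqP; rewrite -normr_eq0.
  by move/psumr_eq0P : su => ->.
rewrite -(ler_pM2r s0) mul1r mulr_sumr.
apply: (@le_trans _ _ (\sum_j \sum_i `|u 0 i| * M i j)).
  apply: ler_sum => j _; have := congr1 (fun v : 'rV_ _ => v 0 j) uM.
  rewrite !mxE => uMj; apply: (@le_trans _ _ `|x * u 0 j|).
    by rewrite normrM ler_wpM2r// ler_norm.
  rewrite -uMj (le_trans (ler_norm_sum _ _ _))//.
  by apply: ler_sum => i _; rewrite normrM (ger0_norm (M0 i j)).
rewrite exchange_big/=; apply: ler_sum => i _.
by rewrite -mulr_sumr M1 mulr1.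
Qed.

(** Summing detailed balance over one index shows that [p] is stationary. *)
Lemma reversible_markov_eigenvalue1 (R : realType) (d : nat)
    (M : 'M[R]_d.+1) :
  markov_matrix M -> reversible_mx M -> eigenvalue M 1.
Proof.
move=> [_ M1] [p [p0 _ pM]]; apply/eigenvalueP; exists p.
  rewrite scale1r; apply/rowP => j; rewrite mxE.
  by under eq_bigr do rewrite pM; rewrite -mulr_sumr M1 mulr1.
apply/eqP => /rowP/(_ ord0); rewrite mxE => h.
by have := p0 ord0; rewrite h ltxx.
Qed.

(** The minimal polynomial is the product of ['X - x%:P] over [s]: this product annihilates [B]
    because it vanishes at every coefficient, and each eigenvalue is a root of the minimal
    polynomial. *)
Lemma size_eigenvalues (F : fieldType) (n : nat) (B : 'M[F]_n.+1)
    (s : seq F) :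
  diagonalizable B -> uniq s -> (forall x, (x \in s) = eigenvalue B x) ->
  size s = degree_mxminpoly B.
Proof.
move=> /diagonalizable_resolution[E [a [resE BE]]] s_uniq sE.
have : mxminpoly B %= \prod_(x <- s) ('X - x%:P).
  rewrite /eqp uniq_roots_dvdp ?uniq_rootsE ?andbT//.
    apply: mxminpoly_min; rewrite BE resolution_horner// big1// => i _.
    have : a i \in s by rewrite sE BE resolution_eigenvalue//; exists i.
    by rewrite -root_prod_XsubC => /rootP ->; rewrite scale0r.
  by apply/allP => x; rewrite sE eigenvalue_root_char -root_mxminpoly.
by move=> /eqp_size; rewrite size_mxminpoly size_prod_XsubC => -[].
Qed.

(** * Detailed balance for polynomials, and positivity of the spectrum *)

Lemma reversible_log_poly (R : realType) (d n : nat) (alpha : 'rV[R]_n)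
    (A : 'M[R]_d.+1) :
  reversible_mx A -> reversible_mx (log_poly alpha A).
Proof.
move=> [p [p0 p1 pA]]; exists p; split=> // i j.
have pAk k : forall i j, p 0 i * (A ^+ k) i j = p 0 j * (A ^+ k) j i.
  elim: k => [|k IHk] {}i {}j.
    by rewrite expr0 !mxE eq_sym; case: eqVneq => [->|]; rewrite ?mulr0.
  (* Expanding the power as [A * A ^+ k] on the left and [A ^+ k * A] on the right lets [p] pass
     through one factor at a time. *)
  rewrite {1}exprS exprSr !mxE !mulr_sumr; apply: eq_bigr => l _.
  by rewrite mulrA pA mulrAC IHk mulrAC -mulrA [X in _ * X]mulrC.
rewrite !summxE !mulr_sumr; apply: eq_bigr => k _.
by rewrite !mxE mulrCA pAk mulrCA.
Qed.

Lemma reversible_subr1 (R : realType) (d : nat) (M : 'M[R]_d.+1) :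
  reversible_mx M -> reversible_mx (M - 1%:M).
Proof.
move=> [p [p0 p1 pM]]; exists p; split=> // i j.
rewrite !mxE !mulrBr pM; congr (_ - _).
by rewrite eq_sym; case: eqVneq => [->|]; rewrite ?mulr0.
Qed.

(** The resolution maps to one over [R[i]], so all complex eigenvalues are images of the real
    [a i]. *)
Lemma positive_spectrum_resolution (R : realType) (n : nat) (I : finType)
    (E : I -> 'M[R]_n.+1) (a : I -> R) :
  spectral_resolution E ->
  positive_spectrum (\sum_i a i *: E i) <-> forall i, 0 < a i.
Proof.
move=> resE; have resCE := resolution_map (real_complex R) resE.
rewrite /positive_spectrum map_mx_sum.
under [X in eigenvalue X]eq_bigr do rewrite map_mxZ.
split=> [h i|h z].
  by rewrite -ltcR; apply/h/(resolution_eigenvalue _ _ resCE); exists i.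
by move=> /(resolution_eigenvalue _ _ resCE)[i ->]; rewrite /= ltcR.
Qed.

(** * The linear system for the coefficients *)

Lemma log_system_unique (R : realType) (n : nat) (lam : seq R) :
  size lam = n.+1 -> uniq lam -> lam`_0 = 1 ->
  exists! alpha : 'rV[R]_n, log_system lam alpha.
Proof.
move=> sz_lam lam_uniq lam0.
pose a : 'rV[R]_n := \row_i (lam`_i.+1 - 1).
pose W := Vandermonde n a *m diag_mx a.
have uW : W \in unitmx.
  rewrite unitmx_mul !unitmxE det_Vandermonde det_diag !unitfE.
  apply/andP; split; last first.
    apply/prodf_neq0 => i _; rewrite mxE subr_eq0 -lam0 nth_uniq ?sz_lam//.
    by rewrite ltnS.
  apply/prodf_neq0 => i _; apply/prodf_neq0 => j ij.
  rewrite !mxE subr_eq0 (can_eq (subrK _)) nth_uniq ?sz_lam ?ltnS//.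
  by rewrite eqSS gtn_eqF.
pose b : 'rV[R]_n := \row_i ln lam`_i.+1.
have sysE alpha : log_system lam alpha <-> alpha *m W = b.
  have WE i : (alpha *m W) 0 i =
      \sum_(k < n) (lam`_i.+1 - 1) ^+ k.+1 * alpha 0 k.
    rewrite mulmxA mul_mx_diag !mxE mulr_suml; apply: eq_bigr => k _.
    by rewrite !mxE -mulrA -exprSr mulrC.
  split=> [h|/rowP h i]; first by apply/rowP => i; rewrite WE h mxE.
  by rewrite -WE h mxE.
exists (b *m invmx W); split; first by apply/sysE; rewrite mulmxKV.
by move=> alpha /sysE <-; rewrite mulmxK.
Qed.

(** The system interpolates [ln] at all eigenvalues but 1; there both sides vanish, since the
    polynomial has no constant term in [x - 1]. *)
Lemma log_system_ln (R : realType) (n : nat) (lam : seq R) (alpha : 'rV[R]_n)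
    (x : R) :
  size lam = n.+1 -> lam`_0 = 1 -> log_system lam alpha -> x \in lam ->
  \sum_(k < n) alpha 0 k * (x - 1) ^+ k.+1 = ln x.
Proof.
move=> sz_lam lam0 sys /(nthP 0)[[|i] + <-].
  rewrite lam0 ln1 subrr => _; rewrite big1// => k _.
  by rewrite exprS mul0r mulr0.
rewrite sz_lam ltnS => i_n; rewrite -(sys (Ordinal i_n)).
by apply: eq_bigr => k _; rewrite mulrC.
Qed.

Lemma resolution_subr1 (F : fieldType) (n : nat) (I : finType)
    (E : I -> 'M[F]_n.+1) (a : I -> F) :
  spectral_resolution E ->
  \sum_i a i *: E i - 1%:M = \sum_i (a i - 1) *: E i.
Proof.
move=> [_ _ E1]; rewrite -[1%:M]/1 -E1 -sumrB.
by apply: eq_bigr => i _; rewrite scalerBl scale1r.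
Qed.

Lemma resolution_log_poly (R : realType) (n m : nat) (I : finType)
    (E : I -> 'M[R]_n.+1) (a : I -> R) (alpha : 'rV[R]_m) :
  spectral_resolution E ->
  log_poly alpha (\sum_i a i *: E i) =
  \sum_i (\sum_(k < m) alpha 0 k * a i ^+ k.+1) *: E i.
Proof.
move=> resE; rewrite /log_poly.
under eq_bigr do rewrite (resolution_exp _ _ resE) scaler_sumr.
rewrite exchange_big; apply: eq_bigr => i _.
by rewrite scaler_suml; apply: eq_bigr => k _; rewrite scalerA.
Qed.

Lemma decreasing_head (R : realType) (lam : seq R) (x : R) :
  sorted >%R lam -> x \in lam -> {in lam, forall y, y <= x} -> lam`_0 = x.
Proof.
case: lam => [//|y s] /= ys; rewrite inE => /predU1P[->//|xs] le_x.
have := le_x y (mem_head _ _).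
have /allP/(_ _ xs) /= := order_path_min (rev_trans lt_trans) ys.
by move=> /lt_le_trans /[apply]; rewrite ltxx.
Qed.

(** * Embeddability criterion and uniqueness of the reversible logarithm *)

Unset Implicit Arguments.

Theorem proposition3p15 (R : realType) (d : nat) (M : 'M[R]_d.+1) (m : nat)
    (lam : seq R) (hmarkov : markov_matrix M) (hrev : reversible_mx M)
    (hm : degree_mxminpoly M = m) (hlam : decreasing_eigenvalues M lam) :
  let A := M - 1%:M in
  [/\ [/\ (m <= d.+1)%N, size lam = m & lam`_0 = 1],
      positive_spectrum M ->
        (exists! alpha : 'rV[R]_m.-1, log_system lam alpha) /\
        (forall alpha : 'rV[R]_m.-1, log_system lam alpha ->
           mxlog1p_series A @ \oo --> log_poly alpha A),
      reversibly_embeddable M <->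
        positive_spectrum M /\
        (forall alpha : 'rV[R]_m.-1, log_system lam alpha ->
           markov_generator (log_poly alpha A))
    & reversibly_embeddable M ->
        forall alpha : 'rV[R]_m.-1, log_system lam alpha ->
          let L := log_poly alpha A in
          [/\ reversible_mx L,
              mxexp L = M
            & forall R' : 'M[R]_d.+1,
                reversible_mx R' -> mxexp R' = M -> R' = L]].
Proof.
move=> A.
have Mdiag := reversible_diagonalizable hrev.
case: hlam => lam_sorted lamE.
have lam_uniq : uniq lam.
  apply: sorted_uniq lam_sorted => [|x]; last exact: ltxx.
  exact: rev_trans lt_trans.
have sz_lam : size lam = m by rewrite -hm (size_eigenvalues Mdiag).
have m_gt0 : (0 < m)%N by rewrite -hm mxminpoly_nonconstant.
have sz_lam' : size lam = m.-1.+1 by rewrite prednK.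
have lam0 : lam`_0 = 1.
  apply: decreasing_head => //.
    by rewrite lamE; exact: reversible_markov_eigenvalue1.
  by move=> y; rewrite lamE; exact: markov_eigenvalue_le1.
have [E [a [resE ME]]] := diagonalizable_resolution Mdiag.
(* Stated for an arbitrary resolution of [M], because uniqueness applies it to the one inherited
   from a candidate logarithm. *)
have lnE (J : finType) (G : J -> 'M[R]_d.+1) b (alpha : 'rV[R]_m.-1) :
    spectral_resolution G -> M = \sum_i b i *: G i -> log_system lam alpha ->
    log_poly alpha A = \sum_i ln (b i) *: G i.
  move=> resG Mb sys; rewrite /A Mb resolution_subr1// resolution_log_poly//.
  apply: eq_bigr => i _; congr (_ *: _); apply: log_system_ln sys _ => //.
  by rewrite lamE Mb resolution_eigenvalue//; exists i.
have expL (alpha : 'rV[R]_m.-1) : positive_spectrum M -> log_system lam alpha ->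
    mxexp (log_poly alpha A) = M.
  rewrite {1}ME positive_spectrum_resolution// => a0 sys.
  rewrite (lnE _ _ _ _ resE ME sys) resolution_mxexp// [RHS]ME.
  (* Positivity enters here: [expR (ln x) = x] requires [0 < x]. *)
  by apply: eq_bigr => i _; rewrite lnK// posrE.
have revL (alpha : 'rV[R]_m.-1) : reversible_mx (log_poly alpha A).
  exact/reversible_log_poly/reversible_subr1.
have logE B : reversible_mx B -> mxexp B = M -> positive_spectrum M /\
    forall alpha : 'rV[R]_m.-1, log_system lam alpha -> B = log_poly alpha A.
  move=> /reversible_diagonalizable/diagonalizable_resolution[G [b [resG ->]]].
  rewrite resolution_mxexp// => expB; split.
    by rewrite -expB positive_spectrum_resolution// => i; exact: expR_gt0.
  move=> alpha /(lnE _ _ _ _ resG (esym expB)) ->.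
  by apply: eq_bigr => i _; rewrite expRK.
split.
- split=> //; rewrite -ltnS -hm -size_mxminpoly -(size_char_poly M).
  apply: dvdp_leq (mxminpoly_dvd_char M).
  by rewrite monic_neq0// char_poly_monic.
- move=> Mpos; split; first exact: log_system_unique.
  move=> alpha sys; rewrite (lnE _ _ _ _ resE ME sys) /A ME resolution_subr1//.
  (* Each [a i] is written as [1 + (a i - 1)] to expose the argument of the series. Its bounds come
     from the Markov property above and from positivity below. *)
  under [X in _ --> X]eq_bigr => i _ do rewrite -(subrKC 1 (a i)).
  apply: resolution_mxlog1p => // i; rewrite subr_le0.
  have -> : a i <= 1.
    apply: (markov_eigenvalue_le1 hmarkov).
    by rewrite ME resolution_eigenvalue//; exists i.
  move: Mpos; rewrite ME positive_spectrum_resolution// => /(_ i); lra.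
- split=> [[Q [genQ revQ MQ]]|[Mpos genL]].
    have [Mpos QE] := logE Q revQ (esym MQ); split=> // alpha sys.
    by rewrite -QE.
  (* Solvability supplies a witness, so the condition over all solutions is not vacuous. *)
  have [alpha [sys _]] := log_system_unique sz_lam' lam_uniq lam0.
  exists (log_poly alpha A); split=> //; first exact: genL.
  by rewrite expL.
- move=> [Q [_ revQ /esym expQ]] alpha sys L.
  have [Mpos _] := logE Q revQ expQ; split; [exact: revL|exact: expL|].
  by move=> B revB expB; have [_ /(_ _ sys)] := logE B revB expB.
Qed.
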